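(* Consider an AC/DC network that consists of either (i) exactly one AC subgrid and multiple (at least two) DC subgrids, or (ii) exactly one DC subgrid and multiple (at least two) AC subgrids. Then the linear AC/DC grid model of the network is a coordinated system; that is, the directions of the converters can be chosen so that the model, with the AC and DC subgrids as its subsystems, is a coordinated system.
   Context: **Network.** $\mathcal{N}^{\mathrm{A}}$ and $\mathcal{N}^{\mathrm{D}}$ are disjoint finite sets of AC and DC buses. $\mathcal{E}^{\mathrm{A}}$ (AC lines) is a set of undirected edges between AC buses and $\mathcal{E}^{\mathrm{D}}$ (DC lines) is a set of undirected edges between DC buses. Converters are links each joining an AC bus to a DC bus (at most one per pair of buses); each converter may be given either direction. A choice of directions gives a set $\mathcal{C}$ of directed edges, with $ij\in\mathcal{C}$ implying $ji\notin\mathcal{C}$. The AC subgrids are the connected components of $(\mathcal{N}^{\mathrm{A}},\mathcal{E}^{\mathrm{A}})$ and the DC subgrids are the connected components of $(\mathcal{N}^{\mathrm{D}},\mathcal{E}^{\mathrm{D}})$. $\mathcal{P}$ is the set of all AC and DC subgrids. **Linear AC/DC grid model.** Each converter $e\in\mathcal{C}$ has one scalar control input $\zeta_e$. The states are the angle $\theta_i$ and frequency $\omega_i$ for each $i\in\mathcal{N}^{\mathrm{A}}$, the voltage $v_i$ for each $i\in\mathcal{N}^{\mathrm{D}}$, and one current for each DC line, written $i_{ij}$ with the convention $i_{ji}=-i_{ij}$. For $i\in\mathcal{N}^{\mathrm{A}}$, $$\dot\theta_i=\omega_i,\qquad J_i\dot\omega_i=P_i-D_i\omega_i-\sum_{j:\,ij\in\mathcal{E}^{\mathrm{A}}}B_{ij}(\theta_i-\theta_j)-\sum_{j:\,ij\in\mathcal{C}}\hat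 v_j\zeta_{ij}+\sum_{j:\,ji\in\mathcal{C}}\hat v_j\zeta_{ji}.$$ For $i\in\mathcal{N}^{\mathrm{D}}$, $$C_i\dot v_i=-\sum_{j:\,ij\in\mathcal{E}^{\mathrm{D}}}i_{ij}-\sum_{j:\,ij\in\mathcal{C}}\zeta_{ij}+\sum_{j:\,ji\in\mathcal{C}}\zeta_{ji}.$$ For each DC line $ij\in\mathcal{E}^{\mathrm{D}}$, $$L_{ij}\dot i_{ij}=v_i-v_j-R_{ij}i_{ij}.$$ Here $J_i,C_i,L_{ij}>0$ and $D_i,B_{ij},R_{ij},\hat v_j$ are real constants, with $B_{ij}=B_{ji}$, $L_{ij}=L_{ji}$, $R_{ij}=R_{ji}$. The $P_i$ (generation or load) are exogenous, not control inputs. The model thus has the form $\dot x=Ax+Bu+Fw$ with $x$ the vector of all states, $u=(\zeta_e)_{e\in\mathcal{C}}$, and $w$ exogenous. **Subsystems.** The subsystems are the elements of $\mathcal{P}$. The states of an AC subgrid are $\theta_i,\omega_i$ for its buses $i$; the states of a DC subgrid are $v_i$ for its buses $i$ and the currents of its lines. The input $\zeta_{ij}$ of converter $ij\in\mathcal{C}$ is assigned to the subgrid containing the tail bus $i$. This partitions $x$ and $u$ into blocks indexed by $\mathcal{P}$ (some input blocks may be empty). **Poset-causality and coordinated systems.** Let $P_{22}(s)=(sI-A)^{-1}B$, with rows partitioned by subsystem states and columns by subsystem inputs; $(P_{22})_{lk}$ is the block with rows in subsystem $l$ and columns in subsystem $k$. For a partial order $\preceq$ on $\mathcal{P}$, the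 system is poset-causal with respect to $\preceq$ if $(P_{22})_{lk}=0$ (as a matrix of rational functions of $s$) whenever $k\not\preceq l$. Write $\downarrow a=\{b\in\mathcal{P}: a\preceq b\}$. The system is a coordinated system if it is poset-causal with respect to a partial order of depth one with a single root: there is a coordinator $c\in\mathcal{P}$ with $\downarrow c=\mathcal{P}$, and $\downarrow i=\{i\}$ for every $i\in\mathcal{P}\setminus\{c\}$. *)

(* Defs.v *)
From HB Require Import structures.
From mathcomp Require Import all_boot all_order all_algebra.
From mathcomp Require Import ring reals.
Set Implicit Arguments.
Unset Strict Implicit.
Unset Printing Implicit Defensive.
Import Order.TTheory GRing.Theory Num.Theory.
Local Open Scope ring_scope.

(* Vectors and matrices are indexed by finite types through [enum_rank] and
   [enum_val]: entry [enum_rank s] of a column is the component of index [s]. *)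

Definition cmp (R : Type) (T : finType) (x : 'cV[R]_#|T|) (s : T) : R :=
  x (enum_rank s) 0.

Section PartitionedSystems.
Variables (R : fieldType) (X U P : finType).
Variables (A : 'M[R]_#|X|) (B : 'M[R]_(#|X|, #|U|)).
Variables (xs : P -> {set X}) (us : P -> {set U}).

Definition rat_const (a : R) : {fraction {poly R}} := tofrac a%:P.

Definition resolvent_pencil : 'M[{fraction {poly R}}]_#|X| :=
  (tofrac 'X)%:M - map_mx rat_const A.

Definition P22 : 'M[{fraction {poly R}}]_(#|X|, #|U|) :=
  invmx resolvent_pencil *m map_mx rat_const B.

(* [invmx] is junk outside [unitmx]; here it is the genuine inverse. *)
Lemma resolvent_pencil_unit : resolvent_pencil \in unitmx.
Proof.
have -> : resolvent_pencil = map_mx (@tofrac {poly R}) (char_poly_mx A).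
  by rewrite /resolvent_pencil map_mxB map_scalar_mx; congr (_ - _);
     apply/matrixP=> i j; rewrite !mxE.
rewrite unitmxE det_map_mx unitfE tofrac_eq0.
exact/monic_neq0/char_poly_monic.
Qed.

Definition P22_block (l k : P) : 'M[{fraction {poly R}}]_(#|xs l|, #|us k|) :=
  mxsub (fun r => enum_rank (enum_val r)) (fun q => enum_rank (enum_val q)) P22.

Definition partial_order (le : rel P) : Prop :=
  [/\ reflexive le, antisymmetric le & transitive le].

Definition poset_causal (le : rel P) : Prop :=
  forall l k : P, ~~ le k l -> P22_block l k = 0.

Definition down (le : rel P) (a : P) : {set P} := [set b | le a b].

Definition coordinated_system : Prop :=
  exists le : rel P, [/\ partial_order le, poset_causal le &
    exists c : P, down le c = [set: P] /\
      forall i : P, i != c -> down le i = [set i]].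

End PartitionedSystems.

Record network := Network {
  acbus : finType;
  dcbus : finType;
  acline : rel acbus;
  dcline : rel dcbus;
  acline_sym : symmetric acline;
  acline_irr : irreflexive acline;
  dcline_sym : symmetric dcline;
  dcline_irr : irreflexive dcline;
  (* undirected: each link is listed with its AC end first *)
  converter : {set acbus * dcbus} }.

Definition components (T : finType) (e : rel T) : {set {set T}} :=
  equivalence_partition (connect e) [set: T].

Section Network.
Variable N : network.

Definition bus : finType := (acbus N + dcbus N)%type.

Definition ac_subgrid : finType :=
  {K : {set acbus N} | K \in components (@acline N)}.
Definition dc_subgrid : finType :=
  {K : {set dcbus N} | K \in components (@dcline N)}.
Definition subgrid : finType := (ac_subgrid + dc_subgrid)%type.

Definition is_converter (e : bus * bus) : bool :=
  match e with
  | (inl i, inr j) | (inr j, inl i) => (i, j) \in converter N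
  | _ => false
  end.

Definition converter_directions (C : {set bus * bus}) : Prop :=
  [/\ forall e, e \in C -> is_converter e,
      forall i j, is_converter (i, j) -> ((i, j) \in C) || ((j, i) \in C) &
      forall i j, (i, j) \in C -> (j, i) \notin C].

(* A DC line is stored once, with its endpoints in enumeration order: this is
   the reference direction of the current that is kept as a state. *)
Definition dcline_state : finType :=
  {l : dcbus N * dcbus N |
    dcline l.1 l.2 && (enum_rank l.1 < enum_rank l.2)%N}.

(* angles, frequencies, voltages, line currents *)
Definition state : finType :=
  (acbus N + acbus N + dcbus N + dcline_state)%type.
Definition st_theta (i : acbus N) : state := inl (inl (inl i)).
Definition st_omega (i : acbus N) : state := inl (inl (inr i)).
Definition st_v (i : dcbus N) : state := inl (inr i).
Definition st_cur (l : dcline_state) : state := inr l.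

Definition input (C : {set bus * bus}) : finType := {e : bus * bus | e \in C}.

Definition substates (p : subgrid) : {set state} :=
  match p with
  | inl K => [set s : state | match s with
      | inl (inl (inl i)) | inl (inl (inr i)) => i \in val K
      | _ => false end]
  | inr K => [set s : state | match s with
      | inl (inr i) => i \in val K
      | inr l => ((val l).1 \in val K) && ((val l).2 \in val K)
      | _ => false end]
  end.

Definition in_subgrid (i : bus) (p : subgrid) : bool :=
  match i, p with
  | inl i, inl K => i \in val K
  | inr i, inr K => i \in val K
  | _, _ => false
  end.

Definition subinputs (C : {set bus * bus}) (p : subgrid) : {set input C} :=
  [set e : input C | in_subgrid (val e).1 p].

Lemma component_uniq (T : finType) (e : rel T) (e_sym : symmetric e) (i : T) :
  exists! K : {K : {set T} | K \in components e}, i \in val K.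
Proof.
have eqv : {in [set: T] & &, equivalence_rel (connect e)}.
  move=> x y z _ _ _; split=> [|xy]; first exact: connect0.
  exact: (same_connect (sym_connect_sym e_sym) xy).
have /and3P[/eqP cov tI _] := equivalence_partitionP eqv.
have ic : i \in cover (components e) by rewrite cov inE.
exists (exist (fun K => K \in components e) _ (pblock_mem ic)); split=> /= [|[K Kc] iK]; first by rewrite mem_pblock.
by apply: val_inj; rewrite /=; apply: def_pblock tI Kc iK.
Qed.

Lemma subgrid_uniq (i : bus) : exists! p : subgrid, in_subgrid i p.
Proof.
case: i => i.
- have [K [iK uK]] := component_uniq (@acline_sym N) i.
  by exists (inl K); split=> // -[K'|K'] //= /uK ->.
- have [K [iK uK]] := component_uniq (@dcline_sym N) i.
  by exists (inr K); split=> // -[K'|K'] //= /uK ->.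
Qed.

Lemma substates_uniq (s : state) : exists! p : subgrid, s \in substates p.
Proof.
have [i ip] : exists i : bus, forall p, (s \in substates p) = in_subgrid i p.
  case: s => [[[i|i]|i]|l].
  - by exists (inl i) => -[K|K]; rewrite inE.
  - by exists (inl i) => -[K|K]; rewrite inE.
  - by exists (inr i) => -[K|K]; rewrite inE.
  exists (inr (val l).1) => -[K|K]; rewrite inE //=.
  apply: andb_idr => lK; have /andP[ll _] := valP l.
  case: K lK => K Kc /= lK; case/imsetP: Kc lK => x _ ->; rewrite !inE /=.
  by move=> xl; exact: connect_trans xl (connect1 ll).
have [p [ipp up]] := subgrid_uniq i.
by exists p; split=> [|q]; rewrite ip //; apply: up.
Qed.

Lemma subinputs_uniq (C : {set bus * bus}) (e : input C) :
  exists! p : subgrid, e \in subinputs C p.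
Proof.
have [p [ipp up]] := subgrid_uniq (val e).1.
by exists p; split=> [|q]; rewrite inE //; apply: up.
Qed.

End Network.

Record grid_params (R : realType) (N : network) := GridParams {
  J : acbus N -> R;
  D : acbus N -> R;
  Bs : acbus N -> acbus N -> R;
  Cap : dcbus N -> R;
  L : dcbus N -> dcbus N -> R;
  Res : dcbus N -> dcbus N -> R;
  vhat : dcbus N -> R;
  J_gt0 : forall i, 0 < J i;
  Cap_gt0 : forall i, 0 < Cap i;
  L_gt0 : forall i j, dcline i j -> 0 < L i j;
  Bs_sym : forall i j, acline i j -> Bs i j = Bs j i;
  L_sym : forall i j, dcline i j -> L i j = L j i;
  Res_sym : forall i j, dcline i j -> Res i j = Res j i }.

Section Model.
Variables (R : realType) (N : network) (g : grid_params R N).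
Variable C : {set bus N * bus N}.

Implicit Types (x : 'cV[R]_#|state N|) (u : 'cV[R]_#|input C|)
  (w : 'cV[R]_#|acbus N|).

Definition theta x i : R := cmp x (st_theta i).
Definition omega x i : R := cmp x (st_omega i).
Definition volt x i : R := cmp x (st_v i).

(* [cur x i j] is the current of line [ij], with [cur x j i = - cur x i j];
   [zeta u i j] is the input of converter [ij] in [C].
   Both are 0 on pairs that are not lines, resp. not in [C]. *)
Definition cur x (i j : dcbus N) : R :=
  if insub (i, j) is Some l then cmp x (st_cur l)
  else if insub (j, i) is Some l then - cmp x (st_cur l)
  else 0.

Definition zeta u (i j : bus N) : R :=
  if insub (i, j) is Some e then cmp u e else 0.

Definition grid_field x u w : 'cV[R]_#|state N| :=
  \col_r match enum_val r : state N with
  | inl (inl (inl i)) => omega x i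
  | inl (inl (inr i)) =>
      (J g i)^-1 * (cmp w i - D g i * omega x i
        - \sum_(j | acline i j) Bs g i j * (theta x i - theta x j)
        - \sum_(j | (inl i, inr j) \in C) vhat g j * zeta u (inl i) (inr j)
        + \sum_(j | (inr j, inl i) \in C) vhat g j * zeta u (inr j) (inl i))
  | inl (inr i) =>
      (Cap g i)^-1 * (- \sum_(j | dcline i j) cur x i j
        - \sum_(j | (inr i, inl j) \in C) zeta u (inr i) (inl j)
        + \sum_(j | (inl j, inr i) \in C) zeta u (inl j) (inr i))
  | inr l => let: (i, j) := val l in
      (L g i j)^-1 * (volt x i - volt x j - Res g i j * cur x i j)
  end.

(* Columns are the values of the vector field on the standard basis. *)
Definition grid_A : 'M[R]_#|state N| :=
  \matrix_(r, q) grid_field (delta_mx q 0) 0 0 r 0.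
Definition grid_B : 'M[R]_(#|state N|, #|input C|) :=
  \matrix_(r, q) grid_field 0 (delta_mx q 0) 0 r 0.
Definition grid_F : 'M[R]_(#|state N|, #|acbus N|) :=
  \matrix_(r, q) grid_field 0 0 (delta_mx q 0) r 0.

Lemma cmp_lin (T : finType) a (x y : 'cV[R]_#|T|) s :
  cmp (a *: x + y) s = a * cmp x s + cmp y s.
Proof. by rewrite /cmp !mxE. Qed.

Lemma cur_lin a x y i j : cur (a *: x + y) i j = a * cur x i j + cur y i j.
Proof. by rewrite /cur; do 2?case: insub => [?|]; rewrite ?cmp_lin; ring. Qed.

Lemma zeta_lin a u v i j : zeta (a *: u + v) i j = a * zeta u i j + zeta v i j.
Proof. by rewrite /zeta; case: insub => [?|]; rewrite ?cmp_lin; ring. Qed.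

Lemma cur_anti x i j : cur x j i = - cur x i j.
Proof.
rewrite /cur; case: insubP => [l /andP[_ /= lji] _|_];
  case: insubP => [l' /andP[_ /= lij] _|_]; rewrite ?opprK ?oppr0 //.
by have := ltn_trans lji lij; rewrite ltnn.
Qed.

Lemma grid_field_lin a x u w x' u' w' :
  grid_field (a *: x + x') (a *: u + u') (a *: w + w') =
  a *: grid_field x u w + grid_field x' u' w'.
Proof.
have sum_lin (I : finType) (p : pred I) (F G H : I -> R) :
    (forall i, H i = a * F i + G i) ->
    \sum_(i | p i) H i = a * (\sum_(i | p i) F i) + \sum_(i | p i) G i.
  by move=> HE; rewrite mulr_sumr -big_split; apply: eq_bigr.
apply/colP => r; rewrite !mxE.
case: (enum_val r) => [[[i|i]|i]|l].
- exact: cmp_lin.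
- rewrite (sum_lin _ (acline i)
                       (fun j => Bs g i j * (theta x i - theta x j))
                       (fun j => Bs g i j * (theta x' i - theta x' j))); last first.
    by move=> j; rewrite /theta !cmp_lin; ring.
  rewrite (sum_lin _ [pred j | (inl i, inr j) \in C]
                       (fun j => vhat g j * zeta u (inl i) (inr j))
                       (fun j => vhat g j * zeta u' (inl i) (inr j))); last first.
    by move=> j; rewrite zeta_lin; ring.
  rewrite (sum_lin _ [pred j | (inr j, inl i) \in C]
                       (fun j => vhat g j * zeta u (inr j) (inl i))
                       (fun j => vhat g j * zeta u' (inr j) (inl i))); last first.
    by move=> j; rewrite zeta_lin; ring.
  by rewrite /omega !cmp_lin; ring.
- rewrite (sum_lin _ (dcline i)
                       (fun j => cur x i j) (fun j => cur x' i j)); last first.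
    by move=> j; rewrite cur_lin.
  rewrite (sum_lin _ [pred j | (inr i, inl j) \in C]
                       (fun j => zeta u (inr i) (inl j))
                       (fun j => zeta u' (inr i) (inl j))); last first.
    by move=> j; rewrite zeta_lin.
  rewrite (sum_lin _ [pred j | (inl j, inr i) \in C]
                       (fun j => zeta u (inl j) (inr i))
                       (fun j => zeta u' (inl j) (inr i))); last first.
    by move=> j; rewrite zeta_lin.
  by ring.
- by case: (val l) => i j; rewrite /volt !cmp_lin cur_lin; ring.
Qed.

(* The model is [x' = A x + B u + F w]. *)
Lemma grid_fieldE x u w :
  grid_field x u w = grid_A *m x + grid_B *m u + grid_F *m w.
Proof.
have fD x1 u1 w1 x2 u2 w2 : grid_field (x1 + x2) (u1 + u2) (w1 + w2) =
    grid_field x1 u1 w1 + grid_field x2 u2 w2.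
  by have := grid_field_lin 1 x1 u1 w1 x2 u2 w2; rewrite !scale1r.
have f0 : grid_field 0 0 0 = 0.
  by apply: (addrI (grid_field 0 0 0)); rewrite -fD !addr0.
have fZ a x1 u1 w1 : grid_field (a *: x1) (a *: u1) (a *: w1) =
    a *: grid_field x1 u1 w1.
  by have := grid_field_lin a x1 u1 w1 0 0 0; rewrite f0 !addr0.
have mxE_of n (f : 'cV[R]_n -> 'cV[R]_#|state N|) (y : 'cV[R]_n) :
    (forall y1 y2, f (y1 + y2) = f y1 + f y2) ->
    (forall a y1, f (a *: y1) = a *: f y1) ->
    f y = (\matrix_(r, q) f (delta_mx q 0) r 0) *m y.
  move=> hD hZ; have h0 : f 0 = 0 by rewrite -(scale0r 0) hZ scale0r.
  rewrite {1}(matrix_sum_delta y) (big_morph f hD h0).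
  apply/colP => r; rewrite summxE mxE; apply: eq_bigr => q _.
  by rewrite big_ord1 hZ !mxE mulrC.
have -> : grid_field x u w =
    grid_field x 0 0 + grid_field 0 u 0 + grid_field 0 0 w.
  by rewrite -!fD !addr0 !add0r.
congr (_ + _ + _).
- apply: (mxE_of _ (fun y => grid_field y 0 0)) => [y1 y2|a y1].
    by rewrite -fD !addr0.
  by rewrite -fZ !scaler0.
- apply: (mxE_of _ (fun y => grid_field 0 y 0)) => [y1 y2|a y1].
    by rewrite -fD !addr0.
  by rewrite -fZ !scaler0.
- apply: (mxE_of _ (fun y => grid_field 0 0 y)) => [y1 y2|a y1].
    by rewrite -fD !addr0.
  by rewrite -fZ !scaler0.
Qed.

Definition grid_coordinated : Prop :=
  coordinated_system grid_A grid_B (@substates N) (@subinputs N C).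

End Model.

(* Main.v *)
Require Import Defs.
From mathcomp Require Import all_boot all_order all_algebra.
From mathcomp Require Import reals.

(** An input [zeta_e] belongs to the subgrid of the tail of [e], and every
    converter has one end on each side of the network.  Direct all converters
    away from the side that has a single subgrid [c]: every input then belongs
    to [c] ([subinputs_converters_from]).  Under the order in which [c] precedes
    everything and the other subgrids are incomparable, the blocks that
    poset-causality requires to vanish all lie in the columns of subgrids other
    than [c], hence have no columns ([coordinated_of_single_actor]). *)

Set Implicit Arguments.
Unset Strict Implicit.
Unset Printing Implicit Defensive.

Section RootedOrder.
Variables (P : finType) (c : P).

Definition root_le : rel P := [rel a b | (a == c) || (a == b)].

Lemma root_le_partial_order : partial_order root_le.
Proof.
rewrite /root_le; split=> [x|x y|y x z] /=; first by rewrite eqxx orbT.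
- by case/andP=> /predU1P[->|/eqP//] /orP[] /eqP.
- by case/orP=> [->|/eqP->].
Qed.

Lemma down_root : down root_le c = [set: P].
Proof. by apply/setP=> x; rewrite /root_le !inE /= eqxx. Qed.

Lemma down_nonroot i : i != c -> down root_le i = [set i].
Proof. by move=> /negPf ic; apply/setP=> x; rewrite /root_le !inE /= ic eq_sym. Qed.

End RootedOrder.

(** The order rooted at [c] forbids influence only from a subsystem other than
    [c]; as such a subsystem has no inputs, the corresponding block of the
    transfer matrix has no entries. *)
Lemma coordinated_of_single_actor (R : fieldType) (X U P : finType)
    (A : 'M[R]_#|X|) (B : 'M[R]_(#|X|, #|U|))
    (xs : P -> {set X}) (us : P -> {set U}) (c : P) :
  (forall k, k != c -> us k = set0) -> coordinated_system A B xs us.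
Proof.
move=> us0; exists (root_le c); split.
- exact: root_le_partial_order.
- move=> l k /norP[/us0 usk _]; apply/matrixP=> r q.
  by have := ltn_ord q; rewrite [X in _ < X](eq_card0 (A := us k)) // => x;
    rewrite usk inE.
- by exists c; split; [exact: down_root | exact: down_nonroot].
Qed.

Section DirectedConverters.
Variable N : network.

Definition is_ac_bus (i : bus N) : bool := if i is inl _ then true else false.
Definition is_ac_subgrid (p : subgrid N) : bool :=
  if p is inl _ then true else false.

(** The two uniform choices of directions, one per value of [b]; in each, the
    coordinator will be the only subgrid of the side of the tails. *)
Definition converters_from (b : bool) : {set bus N * bus N} :=
  [set e | is_converter e && (is_ac_bus e.1 == b)].

Lemma converters_from_directions b : converter_directions (converters_from b).
Proof.
split=> [e|i j|i j]; rewrite !inE /=; first by case/andP.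
- by case: i j b => [i|i] [j|j] [] //= ->.
- by case: i j b => [i|i] [j|j] [] //=; rewrite ?andbF.
Qed.

(** Inputs are assigned by tail, so a subgrid on the side of the heads has
    none. *)
Lemma subinputs_converters_from b (p : subgrid N) :
  is_ac_subgrid p != b -> subinputs (converters_from b) p = set0.
Proof.
move=> pb; apply/setP=> e; rewrite !inE; apply: contraNF pb.
have := valP e; rewrite inE => /andP[_].
by case: (val e).1 p => [i|i] [K|K].
Qed.

Lemma converters_from_coordinated (R : realType) (g : grid_params R N) b
    (c : subgrid N) :
  (forall p, is_ac_subgrid p = b -> p = c) ->
  grid_coordinated g (converters_from b).
Proof.
move=> uniq_c; apply: (@coordinated_of_single_actor _ _ _ _ _ _ _ _ c) => p pc.
by apply: subinputs_converters_from; apply: contra_neq pc; apply: uniq_c.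
Qed.

End DirectedConverters.

Theorem corollary1 (R : realType) (N : network) (g : grid_params R N)
  (hN : (#|ac_subgrid N| = 1 /\ 2 <= #|dc_subgrid N|) \/
        (#|dc_subgrid N| = 1 /\ 2 <= #|ac_subgrid N|)) :
  exists C : {set bus N * bus N},
    converter_directions C /\ grid_coordinated g C.
Proof.
case: hN => -[/eqP/fintype1P[c cP] _].
- exists (converters_from N true); split; first exact: converters_from_directions.
  by apply: (@converters_from_coordinated _ _ _ _ (inl c)) => -[K|K] //= _; rewrite cP.
- exists (converters_from N false); split; first exact: converters_from_directions.
  by apply: (@converters_from_coordinated _ _ _ _ (inr c)) => -[K|K] //= _; rewrite cP.
Qed.
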